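(* Let $A\in\mathbb{C}^{n\times n}$, and let $\lambda\in\mathbb{C}^n$ and $r\in\mathbb{R}^n$ with $r_i\ge 0$ for all $i$ satisfy $\mu(A)\subseteq\bigcup_{i=1}^n\langle\lambda_i,r_i\rangle$. Define $f\in\mathbb{C}^n$ by $$f_i:=\max\bigl(\mathrm{Re}(\lambda_i),\ \lfloor\mathrm{Re}(\lambda_i)\rfloor-\mathrm{Re}(\lambda_i),\ \mathrm{Re}(\lambda_i)-\lceil\mathrm{Re}(\lambda_i)\rceil\bigr)+\mathrm{Im}(\lambda_i)\,\mathsf{i},\qquad i=1,\dots,n.$$ If $\min_i(|f_i|-r_i)>0$, then $\mu(A)\cap\mathbb{Z}_-=\emptyset$.
   Context: $\mu(A)$ denotes the spectrum (set of eigenvalues) of $A$. $\mathbb{Z}_-:=\{z\in\mathbb{Z}: z\le 0\}$ is the set of non-positive integers. For $c\in\mathbb{C}$ and $\rho\ge 0$, $\langle c,\rho\rangle:=\{z\in\mathbb{C}:|z-c|\le\rho\}$ is the complex interval with midpoint $c$ and radius $\rho$. $\lfloor\cdot\rfloor$ and $\lceil\cdot\rceil$ are the floor and ceiling functions, and $\mathsf{i}=\sqrt{-1}$. *)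

(* Defs.v *)
From mathcomp Require Export all_boot all_order all_algebra.
From mathcomp Require Export classical_sets reals.
From mathcomp Require Export complex.

Set Implicit Arguments.
Unset Strict Implicit.
Unset Printing Implicit Defensive.

Import Order.TTheory GRing.Theory Num.Theory.
Local Open Scope ring_scope.
Local Open Scope complex_scope.
Local Open Scope classical_set_scope.

(* The complex modulus as a real number; the norm `|z| of the numeric field
   R[i] is its image (cmod z)%:C. *)
Notation cmod := ComplexField.Normc.normc (only parsing).

(* [eigenvalue] asks for a nonzero row vector v with v *m A = z *: v; a square
   matrix and its transpose have the same eigenvalues. *)
Definition spectrum (F : fieldType) (n : nat) (A : 'M[F]_n) : set F :=
  [set z | eigenvalue A z].

Definition nonpos_ints (R : realType) : set R[i] :=
  [set z | exists2 m : int, m <= 0 & z = m%:~R].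

Definition complex_interval (R : realType) (c : R[i]) (rho : R) : set R[i] :=
  [set z | cmod (z - c) <= rho].

Definition fvec (R : realType) (n : nat) (lambda : 'cV[R[i]]_n) : 'cV[R[i]]_n :=
  \col_i
    let x := complex.Re (lambda i 0) in
    Num.max x (Num.max ((Num.floor x)%:~R - x) (x - (Num.ceil x)%:~R))
      +i* complex.Im (lambda i 0).

(* The bigop's default value is itself an entry, so it does not affect the
   minimum; the index set must be nonempty. *)
Definition min_entry (R : realType) (n : nat) (v : 'I_n.+1 -> R) : R :=
  \big[Num.min/v ord0]_(i < n.+1) v i.

(* Main.v *)
Require Import Defs.
From mathcomp Require Import lra.

(** Write [x] for [Re lambda_i].  The real part of [f_i] has absolute value at
    most the distance from [x] to the non-positive integers: it is [x] when
    [0 <= x], where [0] is the nearest such integer, and otherwise its absolute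
    value is at most the distance to either neighbouring integer [floor x],
    [ceil x], between which no integer lies.  As [f_i] and [lambda_i] have the
    same imaginary part, [|f_i| <= |m - lambda_i|] for every non-positive
    integer [m].  An eigenvalue [m] lies in some disc of centre [lambda_i] and
    radius [r_i], so it would give [|f_i| <= r_i]. *)

Import Order.TTheory GRing.Theory Num.Theory.
Local Open Scope ring_scope.
Local Open Scope complex_scope.
Local Open Scope classical_set_scope.

Lemma min_entry_le (R : realType) (n : nat) (v : 'I_n.+1 -> R) (i : 'I_n.+1) :
  min_entry v <= v i.
Proof. exact: bigmin_le. Qed.

Lemma normc_le_Re (R : realType) (a a' b : R) :
  `|a| <= `|a'| -> cmod (a +i* b) <= cmod (a' +i* b).
Proof.
move=> le_aa'; rewrite /= ler_wsqrtr // lerD2r.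
by rewrite -(real_normK (num_real a)) -(real_normK (num_real a')) ler_sqr ?nnegrE.
Qed.

(** With [x = Re lambda_i] the maximum is [Re f_i]; its absolute value is at
    most the distance from [x] to each non-positive integer. *)
Lemma max_floor_ceil_le_dist (R : realType) (x : R) (m : int) : m <= 0 ->
  `|Num.max x (Num.max ((Num.floor x)%:~R - x) (x - (Num.ceil x)%:~R))|
    <= `|m%:~R - x|.
Proof.
move=> m_le0; have m_le0R : m%:~R <= 0 :> R by rewrite lerz0.
have floor_le := floor_le x; have ceil_ge := ceil_ge x.
have [x_ge0|x_lt0] := leP 0 x.
  (* Both other terms of the maximum are non-positive. *)
  rewrite max_l; last by rewrite ge_max; apply/andP; split; lra.
  by rewrite ger0_norm // ler0_norm; lra.
set M := Num.max x _.
have M_le0 : M <= 0 by rewrite !ge_max; apply/and3P; split; lra.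
have : (Num.floor x)%:~R - x <= M by rewrite !le_max lexx orbT.
have : x - (Num.ceil x)%:~R <= M by rewrite !le_max lexx !orbT.
rewrite (ler0_norm M_le0) => M_ge_ceil M_ge_floor.
have [m_le_x|x_lt_m] := leP m%:~R x.
  have : m%:~R <= (Num.floor x)%:~R :> R by rewrite ler_int floor_ge_int.
  by rewrite ler0_norm; lra.
have : (Num.ceil x)%:~R <= m%:~R :> R by rewrite ler_int ceil_le_int ltW.
by rewrite ger0_norm; lra.
Qed.

Lemma fvec_le_dist (R : realType) (n : nat) (lambda : 'cV[R[i]]_n) (i : 'I_n)
    (z : R[i]) :
  @nonpos_ints R z -> cmod (fvec lambda i 0) <= cmod (z - lambda i 0).
Proof.
case=> m m_le0 ->; rewrite mxE.
have -> : m%:~R = m%:~R%:C :> R[i] by rewrite rmorph_int.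
case: (lambda i 0) => x y /=.
rewrite sub0r sqrrN; apply: normc_le_Re.
exact: max_floor_ceil_le_dist.
Qed.

Theorem theorem4p1 (R : realType) (n : nat) (A : 'M[R[i]]_n.+1)
    (lambda : 'cV[R[i]]_n.+1) (r : 'cV[R]_n.+1)
    (r_ge0 : forall i, 0 <= r i 0)
    (spectrum_enclosed : spectrum A `<=`
       \bigcup_(i in [set: 'I_n.+1]) complex_interval (lambda i 0) (r i 0))
    (min_gt0 : 0 < min_entry (fun i => cmod (fvec lambda i 0) - r i 0)) :
  spectrum A `&` @nonpos_ints R = set0.
Proof.
rewrite -subset0 => z [/spectrum_enclosed [i _ z_in_disc] z_nonpos].
have := lt_le_trans min_gt0 (min_entry_le _ _ _ i).
by rewrite subr_gt0 ltNge (le_trans (fvec_le_dist _ _ lambda i _ z_nonpos) z_in_disc).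
Qed.
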